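(* Let $b\ge 4$ and $n\ge 1$ be integers, let $d$ be a positive integer with $d<b^{1/3}$, and let $c$ be an integer with $0\le c<d$ and $\gcd(c,d)=1$. Put $\alpha=\sqrt{b/d^3}$ and assume $\alpha\ge n^{3/2}+n$. Let $a$ be an integer with $\gcd(a,b)=1$ and $$0<a-b\cdot\frac cd\le \frac{\alpha}{n}-1 .$$ For each positive divisor $r$ of $n$ and each $j\in\{0,\dots,r-1\}$ put $$k(r,j)=\gcd\!\left(\tfrac nr a+jb,\ rb\right),\qquad m(r,j)=\gcd\!\left(\tfrac nr c+jd,\ rd\right),$$ $$a(r,j)=\frac{\frac nr a+jb}{k(r,j)},\quad b(r,j)=\frac{rb}{k(r,j)},\quad c(r,j)=\frac{\frac nr c+jd}{m(r,j)},\quad d(r,j)=\frac{rd}{m(r,j)}.$$ Then for every such pair $(r,j)$, the integer $a(r,j)$ is a Farey neighbour of $b(r,j)\cdot c(r,j)/d(r,j)$ (with respect to $b(r,j)$); hence $S[r,j]:=S\!\left(\tfrac nr a+jb,\ rb\right)=S(a(r,j),b(r,j))$ is positive. Moreover its expected value satisfies $$E[r,j]=\frac{m(r,j)^2}{n}\,E(a,b).$$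
   Context: For a positive integer $B$ and $A\in\mathbb Z$, the normalized Dedekind sum is $S(A,B)=12\sum_{k=1}^{B}((k/B))((Ak/B))$, where $((t))=t-\lfloor t\rfloor-1/2$ for $t\notin\mathbb Z$ and $((t))=0$ for $t\in\mathbb Z$; one has $S(Ad,Bd)=S(A,B)$ for positive integers $d$. Given a positive integer $B\ge 4$, a positive integer $D<B^{1/3}$ and an integer $C$ with $\gcd(C,D)=1$, the number $B\cdot C/D$ is called a Farey point with respect to $B$; an integer $A$ with $\gcd(A,B)=1$ is a Farey neighbour of $B\cdot C/D$ if $0\le A-B\cdot C/D\le \sqrt{B/D^3}-1$. For such $A$, with $Q=AD-BC>0$, the expected value of $S(A,B)$ is $E(A,B)=\frac{B}{DQ}$ (depending on the Farey point $B\cdot C/D$). In particular $E(a,b)=b/(dq)$ with $q=ad-bc$, and $E[r,j]=E(a(r,j),b(r,j))=\frac{b(r,j)}{d(r,j)\,q(r,j)}$ with $q(r,j)=a(r,j)d(r,j)-b(r,j)c(r,j)$. *)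

(* Defs.v *)
From HB Require Import structures.
From mathcomp Require Export all_boot all_order all_algebra.
From mathcomp Require Export reals exp.

Set Implicit Arguments.
Unset Strict Implicit.
Unset Printing Implicit Defensive.

Import Order.TTheory GRing.Theory Num.Theory.
Local Open Scope ring_scope.

Definition sawtooth (R : realType) (t : R) : R :=
  if t \is a Num.int then 0 else t - (Num.floor t)%:~R - 2^-1.

Definition dedekind_sum (R : realType) (A : int) (B : nat) : R :=
  12 * \sum_(1 <= k < B.+1)
         sawtooth (k%:R / B%:R) * sawtooth (A%:~R * k%:R / B%:R).

Definition farey_radius (R : realType) (B D : nat) : R :=
  Num.sqrt (B%:R / D%:R ^+ 3).

(* B * (C / D) is a Farey point with respect to B. *)
Definition farey_point (R : realType) (B : nat) (C : int) (D : nat) : Prop :=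
  [/\ (4 <= B)%N, (0 < D)%N, (D%:R : R) < B%:R `^ 3^-1 & coprimez C D%:Z].

(* A is a Farey neighbour of the Farey point B * (C / D). *)
Definition farey_neighbour (R : realType)
    (A : int) (B : nat) (C : int) (D : nat) : Prop :=
  [/\ farey_point R B C D, coprimez A B%:Z &
      0 <= (A%:~R : R) - B%:R * (C%:~R / D%:R) <= farey_radius R B D - 1].

Definition expected_value (R : realType)
    (A : int) (B : nat) (C : int) (D : nat) : R :=
  B%:R / (D%:R * (A * D%:Z - B%:Z * C)%:~R).

(* With (x, y) = (a, b), the following give (n/r) a + j b, k(r,j), a(r,j), b(r,j);
   with (x, y) = (c, d), they give (n/r) c + j d, m(r,j), c(r,j), d(r,j).
   All the divisions are exact when r divides n. *)
Definition hecke_num (n r j : nat) (x : int) (y : nat) : int :=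
  (n %/ r)%:Z * x + j%:Z * y%:Z.

Definition hecke_gcd (n r j : nat) (x : int) (y : nat) : nat :=
  gcdn `|hecke_num n r j x y|%N (r * y).

Definition reduced_num (n r j : nat) (x : int) (y : nat) : int :=
  (hecke_num n r j x y %/ (hecke_gcd n r j x y)%:Z)%Z.

Definition reduced_den (n r j : nat) (x : int) (y : nat) : nat :=
  ((r * y) %/ hecke_gcd n r j x y)%N.

(* Main.v *)
(* Positivity of S(A,B) for a Farey neighbour A of B C/D rests on the three-term relation
   S(A,B) = S(C,D) + S(t,Q) + (B^2 + D^2 + Q^2)/(B D Q) - 3 with Q = A D - B C,
   together with the Cauchy-Schwarz bound |S(h,k)| <= S(1,k) = (k-1)(k-2)/k: the neighbour
   condition says (Q + D)^2 D <= B, so B/(D Q) outweighs all other terms.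
   For the reduced fractions, k = k(r,j) divides n and Q(r,j) = n Q/(k m); since
   alpha sqrt(m^3/k)/r is the radius at (r,j), being a neighbour reduces to
   alpha (sqrt k - 1) >= r k - n, which is what alpha >= n^(3/2) + n provides. *)
Require Import Defs.
From mathcomp Require Import all_boot all_order all_algebra.
From mathcomp Require Import reals exp.
From mathcomp Require Import ring lra zify.

Import Order.TTheory GRing.Theory Num.Theory.
Local Open Scope ring_scope.

(** * Values and symmetries of the sawtooth function *)

Lemma sawtooth_int {R : realType} (z : int) : sawtooth (z%:~R : R) = 0.
Proof. by rewrite /sawtooth intr_int. Qed.

Lemma sawtooth_itv {R : realType} (t : R) :
  0 < t < 1 -> sawtooth t = t - 2^-1.
Proof.
move=> /andP[t0 t1]; have ft : Num.floor t = 0.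
  by apply: floor_def; rewrite add0r ltW.
rewrite /sawtooth ft subr0; case: ifP => // /intrP[z tz].
by move: t0 t1; rewrite tz -[1]/(1%:~R) ltr0z ltr_int; lia.
Qed.

Lemma sawtoothDz {R : realType} (t : R) (z : int) :
  sawtooth (t + z%:~R) = sawtooth t.
Proof.
rewrite /sawtooth rpredDr ?intr_int//.
by case: ifP => // _; rewrite floorDrz ?intr_int// intrKfloor intrD; ring.
Qed.

Lemma sawtoothN {R : realType} (t : R) : sawtooth (- t) = - sawtooth t.
Proof.
rewrite /sawtooth rpredN; case: ifPn => [_|tz]; first by rewrite oppr0.
have /andP[t1 t2] := floor_itv t.
(* Since [t] is not an integer the floor inequality is strict, which is what places [- t] above
   [- floor t - 1] and strictly below [- floor t]. *)
have tf : (Num.floor t)%:~R != t by rewrite -intrEfloor.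
suff -> : Num.floor (- t) = - Num.floor t - 1.
  by rewrite intrB intrN; field.
apply: floor_def; rewrite subrK intrN ltrN2 lt_neqAle tf t1 andbT.
by rewrite -opprD intrN lerN2 ltW.
Qed.

Lemma sawtooth_modn {R : realType} (i k : nat) : (0 < k)%N ->
  sawtooth (i%:R / k%:R : R) = sawtooth ((i %% k)%:R / k%:R).
Proof.
move=> k0; rewrite -(sawtoothDz ((i %% k)%:R / k%:R) (i %/ k)%:Z).
congr sawtooth; rewrite {1}(divn_eq i k) natrD natrM mulrDl mulfK.
  by rewrite addrC.
by rewrite pnatr_eq0 -lt0n.
Qed.

Lemma sawtooth_frac {R : realType} (i k : nat) : (0 < i < k)%N ->
  sawtooth (i%:R / k%:R : R) = i%:R / k%:R - 2^-1.
Proof.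
move=> /andP[i0 ik]; apply: sawtooth_itv.
have k0 : (0 < k)%N by lia.
by rewrite divr_gt0 ?ltr0n//= ltr_pdivrMr ?ltr0n// mul1r ltr_nat.
Qed.

Lemma sawtooth0 {R : realType} : sawtooth (0 : R) = 0.
Proof. exact: (sawtooth_int 0). Qed.

(** * Periodicity and parity of Dedekind sums *)

Lemma dedekind_sum_addl {R : realType} (A : int) (B : nat) (z : int) :
  (0 < B)%N -> dedekind_sum R (A + z * B%:Z) B = dedekind_sum R A B.
Proof.
move=> B0; rewrite /dedekind_sum; congr (_ * _); apply: eq_bigr => k _.
congr (_ * _); rewrite -[RHS](sawtoothDz _ (z * k%:Z)); congr sawtooth.
rewrite intrD !intrM /= !pmulrn mulrDl mulrDl; congr (_ + _).
have : (B%:R : R) != 0 by rewrite pnatr_eq0 -lt0n.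
by move=> ?; rewrite -!pmulrn; field.
Qed.

Lemma dedekind_sum_modl {R : realType} (A : int) (B : nat) :
  (0 < B)%N -> dedekind_sum R A B = dedekind_sum R (A %% B%:Z)%Z B.
Proof.
by move=> B0; rewrite {1}(divz_eq A B%:Z) addrC dedekind_sum_addl.
Qed.

Lemma dedekind_sumN {R : realType} (A : int) (B : nat) :
  dedekind_sum R (- A) B = - dedekind_sum R A B.
Proof.
rewrite /dedekind_sum -mulrN -sumrN; congr (_ * _); apply: eq_bigr => k _.
by rewrite intrN !mulNr sawtoothN mulrN.
Qed.

Lemma dedekind_sum_natE {R : realType} (h k : nat) : (0 < k)%N ->
  dedekind_sum R h%:Z k = 12 * \sum_(1 <= i < k)
     (i%:R / k%:R - 2^-1) * sawtooth ((h * i)%N%:R / k%:R).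
Proof.
move=> k0; rewrite /dedekind_sum big_nat_recr//= divff ?pnatr_eq0 -?lt0n//.
rewrite -[1]/(1%:~R) sawtooth_int mul0r addr0; congr (_ * _).
rewrite !big_nat; apply: eq_bigr => i ik.
by rewrite sawtooth_frac// -[h%:~R]/(h%:R) natrM.
Qed.

(** * Permuted residues and the Cauchy-Schwarz bound *)

Lemma sum_modn_mul {R : zmodType} (f : nat -> R) (h k : nat) :
  (0 < k)%N -> coprime h k ->
  \sum_(1 <= i < k) f ((h * i) %% k)%N = \sum_(1 <= i < k) f i.
Proof.
(* Multiplication by [h] fixes the residue 0, so the term at 0 is added to both sides; on the full
   finite type of residues injectivity suffices for reindexing. *)
case: k => // k _ hk; apply: (addrI (f 0%N)).
rewrite -{1}(mod0n k.+1) -{1}(muln0 h).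
rewrite -(big_ltn (m := 0) (F := fun i => f ((h * i) %% k.+1)%N))//.
rewrite -(big_ltn (m := 0))// !big_mkord.
pose g (i : 'I_k.+1) : 'I_k.+1 := inord ((h * i) %% k.+1).
have gE i : g i = ((h * i) %% k.+1)%N :> nat by rewrite inordK// ltn_pmod.
have ginj : injective g.
  move=> i j /(congr1 (@nat_of_ord _)); rewrite !gE => /eqP.
  wlog ij : i j / (i <= j)%N => [IH|].
    case: (leqP i j) => [|/ltnW] ij; first exact: IH.
    by rewrite eq_sym => /(IH _ _ ij).
  rewrite eq_sym eqn_mod_dvd ?leq_mul2l ?ij ?orbT// -mulnBr.
  rewrite Gauss_dvdr 1?coprime_sym// => dv; apply/val_inj/eqP => /=.
  move: dv; case: (posnP (j - i)) => [|p /(dvdn_leq p)]; first by lia.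
  by have := ltn_ord j; lia.
rewrite [RHS](reindex_inj ginj) /=.
by apply: eq_bigr => i _; rewrite gE.
Qed.

(** A unit modulo [k] permutes the nonzero residues. It is applied with [f] the identity and with
    [f] the square. *)
Lemma sum_sawtooth_mul {R : realType} (f : R -> R) (h k : nat) :
  (0 < k)%N -> coprime h k ->
  \sum_(1 <= i < k) f (sawtooth ((h * i)%N%:R / k%:R)) =
  \sum_(1 <= i < k) f (i%:R / k%:R - 2^-1).
Proof.
move=> k0 hk; under eq_bigr => i _ do rewrite sawtooth_modn//.
rewrite (sum_modn_mul (fun i => f (sawtooth (i%:R / k%:R))))//.
by rewrite !big_nat; apply: eq_bigr => i ik; rewrite sawtooth_frac.
Qed.

Lemma sum_nat_id {R : numFieldType} (k : nat) : (0 < k)%N ->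
  \sum_(1 <= i < k) (i%:R : R) = k%:R * (k%:R - 1) / 2.
Proof.
elim: k => // k IH _; case: (posnP k) => [->|k0].
  by rewrite big_geq// subrr mulr0 mul0r.
by rewrite big_nat_recr//= IH// -natr1; field.
Qed.

Lemma sum_nat_sqr {R : numFieldType} (k : nat) : (0 < k)%N ->
  \sum_(1 <= i < k) (i%:R ^+ 2 : R) =
  k%:R * (k%:R - 1) * (2 * k%:R - 1) / 6.
Proof.
elim: k => // k IH _; case: (posnP k) => [->|k0].
  by rewrite big_geq// subrr mulr0 mul0r mul0r.
by rewrite big_nat_recr//= IH// -natr1; field.
Qed.

Lemma sum_nat_cst {R : numFieldType} (x : R) (k : nat) : (0 < k)%N ->
  \sum_(1 <= i < k) x = (k%:R - 1) * x.
Proof. by move=> k0; rewrite big_const_nat iter_addr_0 -[x *+ _]mulr_natl natrB. Qed.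

Lemma sum_centered_frac {R : numFieldType} (k : nat) : (0 < k)%N ->
  \sum_(1 <= i < k) (i%:R / k%:R - 2^-1 : R) = 0.
Proof.
move=> k0; rewrite sumrB -mulr_suml sum_nat_id// sum_nat_cst//.
have k1 : (k%:R : R) != 0 by rewrite pnatr_eq0 -lt0n.
by field.
Qed.

Lemma sum_centered_frac_sqr {R : numFieldType} (k : nat) : (0 < k)%N ->
  \sum_(1 <= i < k) (i%:R / k%:R - 2^-1 : R) ^+ 2 =
  (k%:R - 1) * (k%:R - 2) / (12 * k%:R).
Proof.
move=> k0; have k1 : (k%:R : R) != 0 by rewrite pnatr_eq0 -lt0n.
under eq_bigr => i _.
  rewrite (_ : _ ^+ 2 = i%:R ^+ 2 / k%:R ^+ 2 - i%:R / k%:R + 4^-1); last by field.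
  over.
rewrite big_split sumrB -!mulr_suml /= sum_nat_sqr// sum_nat_id// sum_nat_cst//.
by field.
Qed.

(** With [x_i], [y_i] the two sawtooth factors, the sums of [x_i^2] and [y_i^2] agree by
    permutation, so the sum plus the bound equals 6 times the sum of [(x_i + y_i)^2]. *)
Lemma dedekind_sum_ge {R : realType} (A : int) (B : nat) :
  (0 < B)%N -> coprimez A B%:Z ->
  - ((B%:R - 1) * (B%:R - 2) / B%:R) <= dedekind_sum R A B.
Proof.
move=> B0; rewrite dedekind_sum_modl//.
rewrite /coprimez -gcdz_modl -/(coprimez _ _).
have : (0 <= A %% B%:Z)%Z by rewrite modz_ge0//; lia.
case: (A %% B%:Z)%Z => // h _ hB.
have {}hB : coprime h B by move: hB; rewrite /coprimez /coprime /gcdz !absz_nat.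
rewrite dedekind_sum_natE//.
have -> : (B%:R - 1) * (B%:R - 2) / B%:R =
    6 * \sum_(1 <= i < B) (i%:R / B%:R - 2^-1 : R) ^+ 2 +
    6 * \sum_(1 <= i < B) sawtooth ((h * i)%N%:R / B%:R : R) ^+ 2.
  have B1 : (B%:R : R) != 0 by rewrite pnatr_eq0 -lt0n.
  rewrite (sum_sawtooth_mul (fun x => x ^+ 2))// sum_centered_frac_sqr//.
  by field.
rewrite -subr_ge0 opprK !mulr_sumr -!big_split sumr_ge0//= => i _.
have := sqr_ge0 ((i%:R / B%:R - 2^-1 : R) + sawtooth ((h * i)%N%:R / B%:R)).
by rewrite sqrrD -mulr_natl; lra.
Qed.

(** * Invariance under a common factor *)

Lemma dedekind_sum0E {R : realType} (A : int) (B : nat) : (0 < B)%N ->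
  dedekind_sum R A B = 12 * \sum_(0 <= k < B)
    sawtooth (k%:R / B%:R) * sawtooth (A%:~R * k%:R / B%:R).
Proof.
move=> B0; rewrite /dedekind_sum big_nat_recr//= divff ?pnatr_eq0 -?lt0n//.
rewrite [in RHS]big_ltn// mul0r sawtooth0 mul0r add0r.
by rewrite -[1]/(1%:~R) sawtooth_int mul0r addr0.
Qed.

Lemma sum_nat_blocks {R : nmodType} (f : nat -> R) (B d : nat) :
  \sum_(0 <= k < d * B) f k =
  \sum_(0 <= i < d) \sum_(0 <= l < B) f (l + i * B)%N.
Proof.
elim: d => [|d IH]; first by rewrite !big_geq.
rewrite big_nat_recr//= -IH mulSn addnC (big_cat_nat (n := (d * B)%N)) ?leq_addr//=.
by rewrite -{2}[(d * B)%N]add0n big_addn addKn.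
Qed.

(** Writing each index as [l + i * B], the second factor depends only on [l], while the first one,
    summed over [i], obeys the distribution relation of the sawtooth function. *)
Lemma dedekind_sum_scale {R : realType} (A : int) (B d : nat) :
  (0 < B)%N -> (0 < d)%N ->
  dedekind_sum R (A * d%:Z) (B * d) = dedekind_sum R A B.
Proof.
move=> B0 d0; rewrite !dedekind_sum0E ?muln_gt0 ?B0//; congr (_ * _).
have B1 : (B%:R : R) != 0 by rewrite pnatr_eq0 -lt0n.
have d1 : (d%:R : R) != 0 by rewrite pnatr_eq0 -lt0n.
rewrite {1}mulnC sum_nat_blocks exchange_big_nat /=.
rewrite !big_nat; apply: eq_bigr => l /andP[_ lB].
have E i : sawtooth ((A * d%:Z)%:~R * (l + i * B)%:R / (B * d)%:R : R) =
    sawtooth (A%:~R * l%:R / B%:R).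
  rewrite -(sawtoothDz (A%:~R * l%:R / B%:R) (A * i%:Z)); congr sawtooth.
  by rewrite !intrM -!pmulrn natrD !natrM; field; rewrite B1 d1.
under eq_bigr => i _ do rewrite E.
(* At [l = 0] the inner sum meets an integer argument, where the linear formula for the sawtooth
   fails; there the common factor vanishes. *)
rewrite -mulr_suml; case: (posnP l) => [->|l0].
  by rewrite mulr0 mul0r sawtooth0 !mulr0.
congr (_ * _); rewrite sawtooth_frac ?l0//.
rewrite big_nat (eq_bigr (fun i => i%:R / d%:R + (l%:R / (B%:R * d%:R) - 2^-1))).
  rewrite -big_nat big_split /= -mulr_suml.
  rewrite !(@big_ltn _ _ _ 0)// add0r sum_nat_id//.
  by rewrite sum_nat_cst//; field; rewrite B1 d1.
move=> i /andP[_ id]; rewrite sawtooth_frac ?natrD ?natrM; last by nia.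
by field; rewrite B1 d1.
Qed.

(** * Lattice points and the reciprocity law *)

(* Both sides weigh by [2 j] the points [(i, j)] on either side of the diagonal [k j = h i]
   of the rectangle; by coprimality no interior point lies on it. *)
Lemma lattice_count (h k : nat) : (0 < h)%N -> (0 < k)%N -> coprime h k ->
  (\sum_(1 <= i < k) ((h * i) %/ k) * ((h * i) %/ k).+1 +
   2 * \sum_(1 <= j < h) j * ((k * j) %/ h) =
   2 * (k.-1 * \sum_(1 <= j < h) j))%N.
Proof.
move=> h0 k0 hk.
(* Each product on the left is twice a triangular number, hence twice the sum of the heights [j] in
   column [i] below the diagonal. *)
have T m : (m * m.+1 = 2 * \sum_(1 <= j < m.+1) j)%N.
  by elim: m => [|m IH]; [rewrite big_geq | rewrite big_nat_recr//= mulnDr -IH; lia].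
have L : (\sum_(1 <= i < k) ((h * i) %/ k) * ((h * i) %/ k).+1 =
    2 * \sum_(1 <= i < k) \sum_(1 <= j < h | (k * j <= h * i)%N) j)%N.
  rewrite big_distrr /= !big_nat; apply: eq_bigr => i /andP[i0 ik].
  rewrite T; congr muln.
  have fh : ((h * i) %/ k < h)%N by rewrite ltn_divLR// ltn_mul2l h0.
  rewrite [RHS](big_cat_nat (n := ((h * i) %/ k).+1))//=.
  rewrite [X in (_ = _ + X)%N]big1_seq ?addn0.
    rewrite big_nat [RHS]big_nat_cond; apply: eq_bigl => j.
    case: (boolP (1 <= j < _)%N) => //= /andP[_].
    by rewrite ltnS leq_divRL// mulnC => ->.
  move=> j /andP[jl]; rewrite mem_index_iota => /andP[jg _].
  by rewrite ltn_divLR in jg; lia.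
rewrite L (exchange_big_dep_nat xpredT)//= -mulnDr -big_split; congr muln.
rewrite big_distrr /= !big_nat; apply: eq_bigr => j /andP[j0 jh].
have gk : ((k * j) %/ h < k)%N by rewrite ltn_divLR// ltn_mul2l k0.
rewrite (big_cat_nat (n := ((k * j) %/ h).+1))//=.
rewrite [X in (X + _ + _)%N]big1_seq ?add0n => [|i].
  rewrite big_nat_cond (eq_bigl (fun i => ((k * j) %/ h).+1 <= i < k))%N.
    by rewrite -big_nat sum_nat_const_nat; nia.
  move=> i /=; case: (boolP (_ <= i < k)%N) => //= /andP[gi _].
  by rewrite ltn_divLR// [(i * h)%N]mulnC in gi; rewrite ltnW.
move=> /andP[le]; rewrite mem_index_iota => /andP[i0].
rewrite ltnS leq_divRL// => ig; exfalso.
(* A point counted on both sides would lie on the diagonal, so [k] would divide [i], although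
   [0 < i < k]. *)
have e : (h * i = k * j)%N by lia.
have : (k %| h * i)%N by rewrite e dvdn_mulr.
rewrite Gauss_dvdr 1?coprime_sym// => /dvdn_leq -/(_ i0); rewrite leqNgt => /negP; apply.
by rewrite -(ltn_pmul2l h0) e mulnC ltn_mul2r k0.
Qed.

(** The sum of the squares of [sawtooth (h i / k)] is evaluated twice: by permutation of residues,
    and by expansion in terms of floors. The lattice count links this expansion to the sum with [h]
    and [k] exchanged. *)
Lemma dedekind_reciprocity_nat {R : realType} (h k : nat) :
  (0 < h)%N -> (0 < k)%N -> coprime h k ->
  dedekind_sum R h%:Z k + dedekind_sum R k%:Z h =
  h%:R / k%:R + k%:R / h%:R + (h%:R * k%:R)^-1 - 3.
Proof.
have key (u v : nat) : (0 < u)%N -> (0 < v)%N -> coprime u v ->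
    (forall i, (1 <= i < v)%N -> sawtooth ((u * i)%N%:R / v%:R : R) =
       u%:R / v%:R * i%:R - ((u * i) %/ v)%N%:R - 2^-1).
  move=> u0 v0 uv i /andP[i0 iv]; rewrite sawtooth_modn// sawtooth_frac.
    have v1 : (v%:R : R) != 0 by rewrite pnatr_eq0 -lt0n.
    have : ((u * i)%N%:R : R) = ((u * i) %/ v)%N%:R * v%:R + ((u * i) %% v)%N%:R.
      by rewrite -natrM -natrD -divn_eq.
    by rewrite natrM => e; rewrite mulrAC e; field.
  rewrite ltn_pmod// andbT lt0n -/(dvdn v (u * i)) Gauss_dvdr 1?coprime_sym//.
  by apply/negP => /dvdn_leq -/(_ i0); lia.
(* Only the first moment of the floors remains unknown: the constant [- 1/2] of the first factor
   contributes nothing, the permuted sawtooth values having sum 0. *)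
have SE (u v : nat) : (0 < u)%N -> (0 < v)%N -> coprime u v ->
    dedekind_sum R u%:Z v = 12 * (u%:R / v%:R ^+ 2 * \sum_(1 <= i < v) i%:R ^+ 2
      - (\sum_(1 <= i < v) i%:R * ((u * i) %/ v)%N%:R) / v%:R
      - (\sum_(1 <= i < v) i%:R) / (2 * v%:R)).
  move=> u0 v0 uv; rewrite dedekind_sum_natE//; congr (_ * _).
  have v1 : (v%:R : R) != 0 by rewrite pnatr_eq0 -lt0n.
  under eq_bigr => i _ do rewrite mulrBl.
  rewrite sumrB -mulr_sumr (sum_sawtooth_mul (fun x => x))//.
  rewrite sum_centered_frac// mulr0 subr0 mulr_sumr !mulr_suml -!sumrB.
  rewrite !big_nat; apply: eq_bigr => i iv; rewrite key//.
  by field.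
move=> h0 k0 hk; have kh : coprime k h by rewrite coprime_sym.
rewrite !SE//.
have h1 : (h%:R : R) != 0 by rewrite pnatr_eq0 -lt0n.
have k1 : (k%:R : R) != 0 by rewrite pnatr_eq0 -lt0n.
have := sum_sawtooth_mul (fun x : R => x ^+ 2) h k k0 hk.
rewrite sum_centered_frac_sqr//.
have -> : \sum_(1 <= i < k) sawtooth ((h * i)%N%:R / k%:R : R) ^+ 2 =
   h%:R ^+ 2 / k%:R ^+ 2 * (\sum_(1 <= i < k) i%:R ^+ 2)
   + \sum_(1 <= i < k) ((h * i) %/ k * ((h * i) %/ k).+1)%N%:R
   + \sum_(1 <= i < k) 4^-1
   - h%:R / k%:R * (\sum_(1 <= i < k) i%:R)
   - 2 * h%:R / k%:R * (\sum_(1 <= i < k) i%:R * ((h * i) %/ k)%N%:R).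
  rewrite !mulr_sumr -!big_split /= -!sumrB !big_nat; apply: eq_bigr => i ik.
  rewrite key// natrM -natr1; by field.
have /(congr1 (fun x : nat => x%:R : R)) := lattice_count h k h0 k0 hk.
rewrite natrD !natrM !natr_sum -subn1 natrB//.
rewrite [X in _ + _ * X = _ -> _](eq_bigr (fun j => j%:R * ((k * j) %/ h)%N%:R : R)); last first.
  by move=> j _; rewrite natrM.
rewrite !sum_nat_id// !sum_nat_sqr// sum_nat_cst//.
set F := \sum_(_ <= _ < _) _%:R; set Y := \sum_(_ <= _ < _) _; set X := \sum_(_ <= _ < _) _.
move=> e1 e2.
(* The lattice count eliminates [Y], the sum of squares eliminates [F], and the remaining [X]
   cancels between the two Dedekind sums. *)
have -> : Y = (2 * ((k%:R - 1) * (h%:R * (h%:R - 1) / 2)) - F) / 2 by lra.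
have -> : F = (k%:R - 1) * (k%:R - 2) / (12 * k%:R) -
  (h%:R ^+ 2 / k%:R ^+ 2 * (k%:R * (k%:R - 1) * (2 * k%:R - 1) / 6)
   + (k%:R - 1) * 4^-1
   - h%:R / k%:R * (k%:R * (k%:R - 1) / 2)
   - 2 * h%:R / k%:R * X) by lra.
by field; rewrite h1 k1.
Qed.

(** * The three-term relation *)

Lemma dedekind_sum_den1 {R : realType} (A : int) : dedekind_sum R A 1 = 0.
Proof.
by rewrite /dedekind_sum big_nat1 divff ?oner_eq0// (sawtooth_int 1) mul0r mulr0.
Qed.

Lemma coprimez_addMl (A z : int) (B : nat) :
  coprimez (A + z * B%:Z) B%:Z = coprimez A B%:Z.
Proof. by rewrite /coprimez gcdzC addrC gcdzMDl gcdzC. Qed.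

(* The relation is invariant under [SL_2(Z)] acting simultaneously on [A/B] and [C/D]:
   translations fix every term and [x/y |-> -y/x] is controlled by reciprocity,
   so the Euclidean algorithm on [C/D] reduces it to [C/D = 0/1]. *)
Lemma dedekind_three_term {R : realType} (A C : int) (B D Q : nat) :
  (0 < B)%N -> (0 < D)%N -> (0 < Q)%N ->
  coprimez A B%:Z -> coprimez C D%:Z -> A * D%:Z - B%:Z * C = Q%:Z ->
  exists2 t : int, coprimez t Q%:Z &
    dedekind_sum R A B = dedekind_sum R C D + dedekind_sum R t Q
      + (B%:R ^+ 2 + D%:R ^+ 2 + Q%:R ^+ 2) / (B%:R * D%:R * Q%:R) - 3.
Proof.
elim/ltn_ind: D A C B => D IH A C B B0 D0 Q0 cAB cCD eQ.
wlog : A C cAB cCD eQ / 0 <= C < D%:Z => [W|].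
  have := W (A + - (C %/ D%:Z)%Z * B%:Z) (C + - (C %/ D%:Z)%Z * D%:Z).
  rewrite !coprimez_addMl !dedekind_sum_addl//; apply => //.
    by rewrite -eQ; ring.
  have -> : C + - (C %/ D%:Z)%Z * D%:Z = (C %% D%:Z)%Z by rewrite mulNr.
  by rewrite modz_ge0 ?ltz_pmod//; lia.
case: C cCD eQ => // c cCD eQ /andP[_ cD].
have B1 : (B%:R : R) != 0 by rewrite pnatr_eq0 -lt0n.
have D1 : (D%:R : R) != 0 by rewrite pnatr_eq0 -lt0n.
have Q1 : (Q%:R : R) != 0 by rewrite pnatr_eq0 -lt0n.
have : 0 < A by nia.
case: A cAB eQ => // A cAB eQ A0.
have A1 : (A%:R : R) != 0 by rewrite pnatr_eq0; lia.
have {}cAB : coprime A B by move: cAB; rewrite coprimezE !absz_nat.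
have {}cCD : coprime c D by move: cCD; rewrite coprimezE !absz_nat.
have rAB := @dedekind_reciprocity_nat R A B A0 B0 cAB.
(* For [c = 0] coprimality forces [D = 1], hence [A = Q], and the relation is reciprocity for [A]
   and [B] with witness [t = - B]. *)
case: (posnP c) => [c0|c0].
  move: cCD; rewrite c0 /coprime gcd0n => /eqP De.
  have AQ : A = Q by lia.
  exists (- B%:Z); first by rewrite coprimeNz coprimezE !absz_nat coprime_sym -AQ.
  rewrite De dedekind_sum_den1 dedekind_sumN -AQ.
  rewrite (_ : dedekind_sum R A%:Z B = A%:R / B%:R + B%:R / A%:R +
    (A%:R * B%:R)^-1 - 3 - dedekind_sum R B%:Z A); last by lra.
  by field; rewrite A1 B1.
have c1 : (c%:R : R) != 0 by rewrite pnatr_eq0 -lt0n.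
have rCD := @dedekind_reciprocity_nat R c D c0 D0 cCD.
(* The fractions become [- B / A] and [- D / c]: the determinant is still [Q], and the denominator
   has dropped from [D] to [c]. *)
have [|||||t ct e] := IH c _ (- B%:Z) (- D%:Z) A _ c0 Q0.
- by lia.
- by lia.
- by rewrite coprimeNz coprimezE !absz_nat coprime_sym.
- by rewrite coprimeNz coprimezE !absz_nat coprime_sym.
- by rewrite -eQ; ring.
exists t => //; move: e; rewrite !dedekind_sumN => e.
have eQR : (Q%:R : R) = A%:R * D%:R - B%:R * c%:R.
  by have := congr1 (fun z : int => z%:~R : R) eQ; rewrite intrB !intrM.
have -> : dedekind_sum R A%:Z B = A%:R / B%:R + B%:R / A%:R +
    (A%:R * B%:R)^-1 - (c%:R / D%:R + D%:R / c%:R + (c%:R * D%:R)^-1)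
    + dedekind_sum R c%:Z D + (- dedekind_sum R B%:Z A - - dedekind_sum R D%:Z c).
  by lra.
rewrite e; move: Q1; rewrite eQR => Q1.
by field; rewrite A1 B1 c1 D1 Q1.
Qed.

(** * Positivity at a Farey neighbour *)

Lemma dedekind_sum_gt0 {R : realType} (A C : int) (B D : nat) :
  farey_neighbour R A B C D -> 0 < A * D%:Z - B%:Z * C ->
  0 < dedekind_sum R A B.
Proof.
move=> [[B4 D0 _ cCD] cAB /andP[_ hr]] Q0.
have B0 : (0 < B)%N by lia.
move: Q0; case eQ : (A * D%:Z - B%:Z * C) => [Q|//] Q0.
have {}Q0 : (0 < Q)%N by [].
have B1 : 0 < (B%:R : R) by rewrite ltr0n.
have D1 : 1 <= (D%:R : R) by rewrite ler1n.
have Q1 : 1 <= (Q%:R : R) by rewrite ler1n.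
have D2 : (D%:R : R) != 0 by rewrite gt_eqF//; lra.
have eQR : (Q%:R : R) = A%:~R * D%:R - B%:R * C%:~R.
  by have := congr1 (fun z : int => z%:~R : R) eQ; rewrite intrB !intrM.
have [t ct ->] := @dedekind_three_term R A C B D Q B0 D0 Q0 cAB cCD eQ.
have := @dedekind_sum_ge R t Q Q0 ct.
have := @dedekind_sum_ge R C D D0 cCD.
(* As [A - B C / D = Q / D], the neighbour condition reads [Q / D + 1 <= sqrt (B / D^3)]; square it
   and multiply by [D^3]. *)
have hB : (Q%:R + D%:R) ^+ 2 * D%:R <= (B%:R : R).
  have : (Q%:R / D%:R + 1) ^+ 2 <= (B%:R / D%:R ^+ 3 : R).
    rewrite -[leRHS]sqr_sqrtr ?divr_ge0 ?exprn_ge0//.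
    rewrite ler_pXn2r ?nnegrE ?sqrtr_ge0 ?addr_ge0 ?divr_ge0//.
    rewrite -lerBrDr (le_trans _ hr)// le_eqVlt; apply/orP; left; apply/eqP.
    by rewrite eQR; field.
  rewrite ler_pdivlMr ?exprn_gt0//; last by lra.
  by apply: le_trans; rewrite le_eqVlt; apply/orP; left; apply/eqP; field.
have e (x : R) : 1 <= x -> (x - 1) * (x - 2) / x = x - 3 + 2 / x.
  by move=> x1; field; rewrite gt_eqF//; lra.
rewrite !e//.
have h1 : (Q%:R + D%:R) ^+ 2 / Q%:R <=
    ((B%:R ^+ 2 + D%:R ^+ 2 + Q%:R ^+ 2) / (B%:R * D%:R * Q%:R) : R).
  rewrite ler_pdivlMr ?mulr_gt0//; try lra.
  rewrite (_ : _ * _ = B%:R * ((Q%:R + D%:R) ^+ 2 * D%:R)); last first.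
    by field; rewrite gt_eqF//; lra.
  have : B%:R * ((Q%:R + D%:R) ^+ 2 * D%:R) <= B%:R * B%:R :> R.
    by rewrite ler_pM2l.
  by have := sqr_ge0 (D%:R : R); have := sqr_ge0 (Q%:R : R); rewrite [B%:R ^+ 2]expr2; lra.
(* This expansion absorbs the two Cauchy-Schwarz losses and the [- 3]: what is left is at least
   [D + 3 - 2 / D - 1 / Q], hence at least 1. *)
have e2 : (Q%:R + D%:R) ^+ 2 / Q%:R =
    Q%:R + 2 * D%:R + 2 / Q%:R + (D%:R ^+ 2 - 1) / Q%:R - Q%:R^-1 :> R.
  by field; rewrite gt_eqF//; lra.
have h2 : 0 <= (D%:R ^+ 2 - 1) / Q%:R :> R.
  by rewrite divr_ge0// subr_ge0 exprn_ege1.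
have h3 : Q%:R^-1 <= 1 :> R by rewrite invf_le1//; lra.
have h4 : 2 / D%:R <= 2 :> R by rewrite ler_pdivrMr; lra.
by move: h1; rewrite e2; lra.
Qed.

(** * Reduced fractions and their determinant *)

Lemma hecke_gcd_gt0 (n r j : nat) (x : int) (y : nat) :
  (0 < r)%N -> (0 < y)%N -> (0 < hecke_gcd n r j x y)%N.
Proof. by move=> r0 y0; rewrite gcdn_gt0 muln_gt0 r0 y0 orbT. Qed.

Lemma reduced_numK (n r j : nat) (x : int) (y : nat) :
  reduced_num n r j x y * (hecke_gcd n r j x y)%:Z = hecke_num n r j x y.
Proof. by apply: divzK; exact: dvdn_gcdl. Qed.

Lemma reduced_denK (n r j : nat) (x : int) (y : nat) :
  (reduced_den n r j x y * hecke_gcd n r j x y = r * y)%N.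
Proof. by apply: divnK; exact: dvdn_gcdr. Qed.

Lemma coprimez_reduced (n r j : nat) (x : int) (y : nat) :
  (0 < r)%N -> (0 < y)%N ->
  coprimez (reduced_num n r j x y) (reduced_den n r j x y)%:Z.
Proof.
move=> r0 y0; have k0 := hecke_gcd_gt0 n r j x y r0 y0.
rewrite coprimezE /coprime absz_nat -(eqn_pmul2r k0) mul1n muln_gcdl.
have -> : (`|reduced_num n r j x y| * hecke_gcd n r j x y)%N =
    `|hecke_num n r j x y|%N by rewrite -reduced_numK abszM.
by rewrite reduced_denK.
Qed.

(** A Bezout relation [u x + v y = 1] multiplied by [n] writes [n] as a combination of the two
    arguments of the gcd. *)
Lemma hecke_gcd_dvd (n r j : nat) (x : int) (y : nat) :
  (r %| n)%N -> coprimez x y%:Z -> (hecke_gcd n r j x y %| n)%N.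
Proof.
move=> rn /coprimezP[[u v] /= e]; have en := divnK rn.
have -> : (hecke_gcd n r j x y %| n)%N = ((hecke_gcd n r j x y)%:Z %| n%:Z)%Z by [].
have -> : n%:Z = u * r%:Z * hecke_num n r j x y +
    ((n %/ r)%:Z * v - u * j%:Z) * (r * y)%:Z.
  rewrite /hecke_num -{1}en !PoszM -[LHS]mulr1 -e; ring.
by apply: rpredD; apply: dvdz_mull; [exact: dvdn_gcdl | exact: dvdn_gcdr].
Qed.

(** The unreduced pairs are the images of [(a, b)] and [(c, d)] under the matrix with rows
    [(n/r, j)] and [(0, r)], of determinant [n]; each gcd is a factor taken out of one pair. *)
Lemma hecke_det (n r j : nat) (a c : int) (b d : nat) : (r %| n)%N ->
  (reduced_num n r j a b * (reduced_den n r j c d)%:Z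
   - (reduced_den n r j a b)%:Z * reduced_num n r j c d) *
  ((hecke_gcd n r j a b)%:Z * (hecke_gcd n r j c d)%:Z) =
  n%:Z * (a * d%:Z - b%:Z * c).
Proof.
move=> rn; have := reduced_numK n r j a b; have := reduced_numK n r j c d.
have := congr1 Posz (reduced_denK n r j a b).
have := congr1 Posz (reduced_denK n r j c d).
rewrite /hecke_num !PoszM => ed eb ec ea.
transitivity (((n %/ r)%:Z * a + j%:Z * b%:Z) * (r%:Z * d%:Z) -
  (r%:Z * b%:Z) * ((n %/ r)%:Z * c + j%:Z * d%:Z)).
  by rewrite -ed -eb -ec -ea; ring.
have -> : n%:Z = (n %/ r)%:Z * r%:Z by rewrite -PoszM divnK.
by ring.
Qed.

(** * Real powers *)

Lemma lt_powR_inv3 {R : realType} (x y : R) :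
  0 <= x -> x ^+ 3 < y -> x < y `^ 3^-1.
Proof.
move=> x0 xy; have {1}-> : x = (x ^+ 3) `^ 3^-1.
  by rewrite -powR_mulrn// -powRrM mulfV ?pnatr_eq0// powRr1.
have x3 : 0 <= x ^+ 3 by rewrite exprn_ge0.
by rewrite gt0_ltr_powR ?nnegrE ?invr_gt0// (le_trans x3) ?ltW.
Qed.

Lemma powR_3_2 {R : realType} (x : R) : 0 < x -> x `^ (3 / 2) = x * Num.sqrt x.
Proof.
move=> x0; rewrite (_ : 3 / 2 = 1 + 2^-1) ?powRD ?powRr1 ?powR12_sqrt ?ltW//.
  by rewrite (gt_eqF x0) implybT.
by field.
Qed.

Theorem theorem1 (R : realType) (b n d : nat) (c a : int)
  (hb : (4 <= b)%N) (hn : (1 <= n)%N)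
  (hd0 : (0 < d)%N) (hd : (d%:R : R) < b%:R `^ 3^-1)
  (hc : 0 <= c < d%:Z) (hcd : coprimez c d%:Z)
  (alpha : R) (halpha : alpha = Num.sqrt (b%:R / d%:R ^+ 3))
  (hn_alpha : n%:R `^ (3 / 2) + n%:R <= alpha)
  (hab : coprimez a b%:Z)
  (ha : 0 < (a%:~R : R) - b%:R * (c%:~R / d%:R) <= alpha / n%:R - 1) :
  forall r j : nat, (r %| n)%N -> (j < r)%N ->
  let m_rj := hecke_gcd n r j c d in
  let a_rj := reduced_num n r j a b in
  let b_rj := reduced_den n r j a b in
  let c_rj := reduced_num n r j c d in
  let d_rj := reduced_den n r j c d in
  let S_rj := dedekind_sum R (hecke_num n r j a b) (r * b) in
  [/\ farey_neighbour R a_rj b_rj c_rj d_rj,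
      S_rj = dedekind_sum R a_rj b_rj,
      0 < S_rj &
      expected_value R a_rj b_rj c_rj d_rj
        = (m_rj%:R ^+ 2 / n%:R) * expected_value R a b c d].
Proof.
move=> r j rn jr m_rj a_rj b_rj c_rj d_rj S_rj.
have r0 : (0 < r)%N by apply: leq_ltn_trans jr.
have b0 : (0 < b)%N by apply: leq_trans hb.
have rlen : (r <= n)%N by apply: dvdn_leq.
pose k := hecke_gcd n r j a b.
have k0 : (0 < k)%N := hecke_gcd_gt0 n r j a b r0 b0.
have m0 : (0 < m_rj)%N := hecke_gcd_gt0 n r j c d r0 hd0.
have kn : (k <= n)%N by apply: dvdn_leq => //; exact: hecke_gcd_dvd.
have eb : (b_rj * k = r * b)%N := reduced_denK n r j a b.
have ed : (d_rj * m_rj = r * d)%N := reduced_denK n r j c d.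
have b'0 : (0 < b_rj)%N by rewrite -(ltn_pmul2r k0) mul0n eb muln_gt0 r0.
have d'0 : (0 < d_rj)%N by rewrite -(ltn_pmul2r m0) mul0n ed muln_gt0 r0.
have det := hecke_det n r j a c b d rn.
rewrite -/k -/a_rj -/b_rj -/c_rj -/d_rj -/m_rj in det.
pose q := a * d%:Z - b%:Z * c; pose q' := a_rj * d_rj%:Z - b_rj%:Z * c_rj.
rewrite -/q -/q' in det.
have S_eq : S_rj = dedekind_sum R a_rj b_rj.
  by rewrite /S_rj -eb -reduced_numK dedekind_sum_scale.
have natr_gt0 (i : nat) : (0 < i)%N -> 0 < (i%:R : R) by rewrite ltr0n.
have [[[bR dR] nR] rR] := (natr_gt0 b b0, natr_gt0 d hd0, natr_gt0 n hn, natr_gt0 r r0).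
have [[[kR mR] b'R] d'R] :=
  (natr_gt0 k k0, natr_gt0 _ m0, natr_gt0 _ b'0, natr_gt0 _ d'0).
have q0 : 0 < q.
  suff : 0 < (q%:~R : R) by rewrite ltr0z.
  move: ha => /andP[]; rewrite intrB !intrM -(pmulr_lgt0 _ dR) /=.
  by rewrite -!pmulrn mulrBl mulrA divfK ?gt_eqF.
have q'0 : 0 < q' by rewrite /k in det; nia.
have [[[bF dF] nF] rF] := (lt0r_neq0 bR, lt0r_neq0 dR, lt0r_neq0 nR, lt0r_neq0 rR).
have [[[kF mF] b'F] d'F] :=
  (lt0r_neq0 kR, lt0r_neq0 mR, lt0r_neq0 b'R, lt0r_neq0 d'R).
have q1 : (q%:~R : R) != 0 by rewrite intr_eq0 gt_eqF.
have ebR : (b_rj%:R : R) = r%:R * b%:R / k%:R.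
  by rewrite -natrM -eb natrM mulfK.
have edR : (d_rj%:R : R) = r%:R * d%:R / m_rj%:R.
  by rewrite -natrM -ed natrM mulfK.
have eqR : (q'%:~R : R) = n%:R * q%:~R / (k%:R * m_rj%:R).
  apply: (canRL (mulfK _)); first by rewrite mulf_neq0.
  by have := congr1 (fun z : int => z%:~R : R) det; rewrite !intrM.
have neighbour : farey_neighbour R a_rj b_rj c_rj d_rj.
  pose s := Num.sqrt (n%:R : R); pose kap := Num.sqrt (k%:R : R).
  have s2 : s ^+ 2 = n%:R by rewrite sqr_sqrtr// ltW.
  have kap2 : kap ^+ 2 = k%:R by rewrite sqr_sqrtr// ltW.
  have kap1 : 1 <= kap by rewrite -sqrtr1 ler_sqrt// ler1n.
  have kaps : kap <= s by rewrite ler_sqrt// ler_nat.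
  have kap0 : 0 < kap by lra.
  have [k1R n1R r1R] : [/\ 1 <= (k%:R : R), 1 <= (n%:R : R) & 1 <= (r%:R : R)].
    by rewrite !ler1n.
  have rnR : (r%:R : R) <= n%:R by rewrite ler_nat.
  have al : n%:R * (s + 1) <= alpha by move: hn_alpha; rewrite powR_3_2// -/s; lra.
  have al0 : 0 < alpha by apply: lt_le_trans al; rewrite mulr_gt0//; lra.
  have al2 : alpha ^+ 2 = b%:R / d%:R ^+ 3.
    by rewrite halpha sqr_sqrtr// divr_ge0 ?exprn_ge0// ltW.
  (* The radius at [(r, j)] is [rho] times [m_rj^(3/2)]; since [m_rj >= 1], working with [rho]
     suffices and removes the dependence on [m_rj]. *)
  pose rho := alpha / (kap * r%:R).
  have rho2 : rho ^+ 2 <= b_rj%:R / d_rj%:R ^+ 3.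
    have -> : b_rj%:R / d_rj%:R ^+ 3 = rho ^+ 2 * m_rj%:R ^+ 3 :> R.
      rewrite /rho expr_div_n al2 exprMn kap2 ebR edR; field.
      by rewrite ?kF ?mF ?rF ?dF.
    by rewrite ler_peMr ?sqr_ge0// exprn_ege1// ler1n.
  (* After clearing [r k] the claim is [alpha (kap - 1) >= r k - n]. It follows from
     [alpha >= n (s + 1) >= n (kap + 1)], [kap^2 = k] and [r <= n]. *)
  have rho_ge : (alpha - n%:R) / (r%:R * k%:R) + 1 <= rho.
    have -> : rho = alpha * kap / (r%:R * k%:R).
      by rewrite /rho -kap2; field; rewrite rF gt_eqF.
    rewrite ler_pdivlMr ?mulr_gt0// mulrDl divfK ?mulf_neq0// mul1r.
    have h1 : n%:R * (kap + 1) * (kap - 1) <= alpha * (kap - 1).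
      rewrite ler_wpM2r; first by [].
        by lra.
      by apply: le_trans al; rewrite ler_pM2l//; lra.
    have h2 : n%:R * (kap + 1) * (kap - 1) = n%:R * k%:R - n%:R.
      by rewrite -kap2; ring.
    have h3 : r%:R * k%:R <= n%:R * k%:R :> R by rewrite ler_pM2r.
    by lra.
  (* Together with [rho2] this yields [d_rj^3 < b_rj], the size condition for a Farey point. *)
  have rho1 : 1 < rho.
    rewrite /rho ltr_pdivlMr ?mulr_gt0// mul1r; apply: lt_le_trans al.
    have h1 : kap * r%:R <= s * n%:R by rewrite ler_pM//; lra.
    by lra.
  split; last 1 first.
  - have -> : (a_rj%:~R : R) - b_rj%:R * (c_rj%:~R / d_rj%:R) = q'%:~R / d_rj%:R.
      by rewrite /q' intrB !intrM -!pmulrn; field.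
    rewrite divr_ge0 ?ler0z ?(ltW q'0) ?(ltW d'R)//=.
    rewrite lerBrDr; apply: (@le_trans _ _ rho); last first.
      have rho0 : 0 <= rho by lra.
      by rewrite -[leLHS](ger0_norm rho0) -sqrtr_sqr ler_wsqrtr.
    apply: le_trans rho_ge; rewrite lerD2r eqR edR.
    have -> : n%:R * q%:~R / (k%:R * m_rj%:R) / (r%:R * d%:R / m_rj%:R) =
       n%:R * (q%:~R / d%:R) / (r%:R * k%:R) :> R.
      by field; rewrite ?kF ?mF ?rF ?dF.
    rewrite ler_pM2r ?invr_gt0 ?mulr_gt0//.
    have -> : alpha - n%:R = n%:R * (alpha / n%:R - 1) by field.
    rewrite ler_pM2l//; move: ha => /andP[_]; apply: le_trans.
    rewrite le_eqVlt; apply/orP; left; apply/eqP.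
    by rewrite /q intrB !intrM -!pmulrn; field.
  - split => //; last exact: coprimez_reduced.
      (* Here [b >= alpha^2 >= (2 n)^2 >= 4 n]; as [k <= n], it follows that
         [b_rj = r b / k >= 4]. *)
      have : 4 * n%:R <= b%:R :> R.
        have : alpha ^+ 2 <= b%:R.
          by rewrite al2 ler_pdivrMr ?exprn_gt0// ler_peMr ?(ltW bR)// exprn_ege1// ler1n.
        apply: le_trans.
        have : (2 * n%:R) ^+ 2 <= alpha ^+ 2.
          rewrite ler_pXn2r ?nnegrE ?(ltW al0)//; last by lra.
          by apply: le_trans al; rewrite mulrC ler_pM2l//; lra.
        apply: le_trans; rewrite (_ : _ ^+ 2 = 4 * n%:R * n%:R); last by ring.
        by rewrite ler_peMr ?mulr_ge0 ?(ltW nR).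
      rewrite -natrM ler_nat => bn; rewrite -(leq_pmul2r k0) eb.
      by apply: leq_trans (leq_pmull b r0); apply: leq_trans bn; rewrite leq_mul2l.
    apply: lt_powR_inv3; first exact: ltW.
    rewrite -[ltLHS]mul1r -ltr_pdivlMr ?exprn_gt0//.
    by apply: lt_le_trans rho2; rewrite expr_gt1//; lra.
  - exact: coprimez_reduced.
split=> //; first by rewrite S_eq; exact: dedekind_sum_gt0 neighbour q'0.
(* Both [r] and [k] cancel; one factor [m_rj] comes from [d_rj] and the other from [q']. *)
rewrite /expected_value -/q -/q' eqR ebR edR.
by field; rewrite ?nF ?kF ?mF ?rF ?dF ?q1.
Qed.
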